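(* Let $M$ be a smooth manifold, let $\mathcal{B}(M)$ be a basis for the topology of $M$ consisting of open subsets diffeomorphic to an open ball, and let $\mathcal{B}^{(1)}(M)$ be the associated category. Then the category $VGVB(\mathcal{B}^{(1)}(M))$ of very good vector bundles over $M$ is an abelian category.
   Context: $\mathbb{K}$ is a (topological) field and $f\mathrm{Vect}_{\mathbb{K}}$ is the category of finite dimensional $\mathbb{K}$-vector spaces; each is given its product topology (via any choice of basis). $\mathcal{B}^{(1)}(M)$ is the category whose objects are the elements of $\mathcal{B}(M)$ and whose morphisms are inclusions (an inclusion of one open ball in another is automatically an isotopy equivalence). A covariant functor $F\colon\mathcal{B}^{(1)}(M)\to f\mathrm{Vect}_{\mathbb{K}}$ is very good if it sends isotopy equivalences (here: all morphisms) to isomorphisms. An object of $VGVB(\mathcal{B}^{(1)}(M))$ (a very good vector bundle) is a triple $(E,\pi,F_\pi)$, where $E$ is a topological space, $\pi\colon E\to M$ is a continuous surjection and $F_\pi\colon\mathcal{B}^{(1)}(M)\to f\mathrm{Vect}_{\mathbb{K}}$ is a very good covariant functor, endowed with a family of homeomorphisms $\varphi^\pi_U\colon U\times F_\pi(U)\to\pi^{-1}(U)$, $U\in\mathcal{B}^{(1)}(M)$, such that: (VB0) for every $x\in M$, $\pi^{-1}(x)$ is a ($\mathbb{K}$-)vector space; (VB1) $(\pi\circ\varphi^\pi_U)(x,v)=x$ for all $U$ and all $(x,v)\in U\times F_\pi(U)$; (VB2) for all $U$ and $x\in U$, the map $\varphi^\pi_{xU}\colon F_\pi(U)\to\pi^{-1}(x)$,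 $v\mapsto\varphi^\pi_U(x,v)$, is an isomorphism of vector spaces; (VB3) for every morphism $j\colon U\hookrightarrow V$ of $\mathcal{B}^{(1)}(M)$, one has $\varphi^\pi_V\circ(j\times F_\pi(j))=\varphi^\pi_U$ as maps $U\times F_\pi(U)\to\pi^{-1}(V)$ (using $\pi^{-1}(U)\subseteq\pi^{-1}(V)$). A morphism $(X,p,F_p)\to(Y,q,F_q)$ is a pair $(f,\eta)$ where $f\colon X\to Y$ is a continuous map with $qf=p$ and $\eta\colon F_p\to F_q$ is a natural transformation such that for every $U\in\mathcal{B}^{(1)}(M)$, $f\circ\varphi^p_U=\varphi^q_U\circ(\mathrm{id}\times\eta[U])$ on $U\times F_p(U)$, where $\eta[U]$ is the component of $\eta$ at $U$. *)

(* Defs.v *)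
From HB Require Import structures.
From mathcomp Require Import all_boot all_order all_algebra.
From mathcomp Require Import all_classical all_reals all_analysis.

Set Implicit Arguments.
Unset Strict Implicit.
Unset Printing Implicit Defensive.

Import Order.TTheory GRing.Theory Num.Theory.
Import numFieldNormedType.Exports.

Local Open Scope classical_set_scope.
Local Open Scope ring_scope.

Section smooth_maps.
Context {R : realType} {m n : nat}.
Implicit Types (U : set 'rV[R]_m) (f : 'rV[R]_m -> 'rV[R]_n).

(* Only meaningful when U is open. *)
Fixpoint Ck (k : nat) U f : Prop :=
  {in U, continuous f} /\
  (if k is k'.+1 then
     forall i : 'I_m, (forall x, U x -> derivable f x (delta_mx 0 i)) /\
       Ck k' U (fun x => 'D_(delta_mx 0 i) f x)
   else True).

Definition smooth_on U f := forall k, Ck k U f.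

End smooth_maps.

(* The Euclidean ball: the library norm on row vectors is the sup norm. *)
Definition eucl_ball (R : realType) (n : nat) (a : 'rV[R]_n) (r : R) :
  set 'rV[R]_n := [set y | \sum_(i < n) (y 0 i - a 0 i) ^+ 2 < r ^+ 2].

(* cmap and cinv are total functions whose values matter only on cdom and
   cmap @` cdom respectively. *)
Record chart (R : realType) (n : nat) (M : topologicalType) := Chart {
  cdom : set M;
  cmap : M -> 'rV[R]_n;
  cinv : 'rV[R]_n -> M;
  cdom_open : open cdom;
  cimg_open : open (cmap @` cdom);
  cmapK : forall x, cdom x -> cinv (cmap x) = x;
  cmap_continuous : {in cdom, continuous cmap};
  cinv_continuous : {in cmap @` cdom, continuous cinv} }.

Record smooth_manifold (R : realType) (n : nat) := SmoothManifold {
  carrier :> topologicalType;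
  atlas : set (chart R n carrier);
  carrier_hausdorff : hausdorff_space carrier;
  carrier_second_countable : @second_countable carrier;
  atlas_cover : forall x : carrier, exists2 c, atlas c & cdom c x;
  atlas_compatible : forall c d, atlas c -> atlas d ->
    smooth_on (cmap c @` (cdom c `&` cdom d)) (cmap d \o cinv c) }.

Section diffeo_ball.
Context {R : realType} {n : nat} {M : smooth_manifold R n}.

Definition smooth_from (U : set M) (f : M -> 'rV[R]_n) :=
  forall c, atlas c -> smooth_on (cmap c @` (cdom c `&` U)) (f \o cinv c).

Definition smooth_to (V : set 'rV[R]_n) (g : 'rV[R]_n -> M) :=
  {in V, continuous g} /\
  forall c, atlas c -> smooth_on (V `&` g @^-1` cdom c) (cmap c \o g).

Definition diffeomorphic_to_open_ball (U : set M) :=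
  exists (a : 'rV[R]_n) (r : R), 0 < r /\
  exists (f : M -> 'rV[R]_n) (g : 'rV[R]_n -> M),
    [/\ f @` U = eucl_ball a r, {in U, cancel f g},
        smooth_from U f & smooth_to (eucl_ball a r) g].

End diffeo_ball.

HB.mixin Record TopologicalZmodule_isTopologicalField K
    & GRing.Field K & TopologicalZmodule K := {
  mul_continuous : continuous (fun x : K * K => x.1 * x.2);
  inv_continuous : forall x : K, x != 0 -> {for x, continuous (@GRing.inv K)} }.

#[short(type="topologicalFieldType")]
HB.structure Definition TopologicalField :=
  {K of GRing.Field K & TopologicalZmodule K
      & TopologicalZmodule_isTopologicalField K}.

(* The topology transported from K^d by the coordinates in the basis chosen by
   vbasis; since linear maps between powers of K are continuous, any other basis
   gives the same topology. *)
Definition fvtop (K : topologicalFieldType) (V : vectType K) : topologicalType :=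
  initial_topology (fun v : V => \row_i coord (vbasis fullv) i v).

Record category := Category {
  obj :> Type;
  hom : obj -> obj -> Type;
  idm : forall a, hom a a;
  comp : forall a b c, hom b c -> hom a b -> hom a c;
  comp1m : forall a b (f : hom a b), comp (idm b) f = f;
  compm1 : forall a b (f : hom a b), comp f (idm a) = f;
  compmA : forall a b c d (h : hom c d) (g : hom b c) (f : hom a b),
    comp h (comp g f) = comp (comp h g) f }.


Definition is_iso (C : category) (a b : C) (f : hom a b) :=
  exists g : hom b a, comp g f = idm a /\ comp f g = idm b.

Record functor (C D : category) := Functor {
  fobj :> C -> D;
  fmap : forall a b, hom a b -> hom (fobj a) (fobj b);
  fmap1 : forall a, fmap (idm a) = idm (fobj a);
  fmapM : forall a b c (g : hom b c) (f : hom a b),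
    fmap (comp g f) = comp (fmap g) (fmap f) }.

Record nat_trans (C D : category) (F G : functor C D) := NatTrans {
  component :> forall a, hom (F a) (G a);
  naturality : forall a b (f : hom a b),
    comp (component b) (fmap F f) = comp (fmap G f) (component a) }.

Lemma nat_trans_eq (C D : category) (F G : functor C D) (s t : nat_trans F G) :
  (forall a, s a = t a) -> s = t.
Proof.
case: s t => [s sP] [t tP] /= st.
have {}st : s = t by apply: functional_extensionality_dep.
by subst t; congr NatTrans; exact: Prop_irrelevance.
Qed.

Program Definition nat_id (C D : category) (F : functor C D) : nat_trans F F :=
  NatTrans (component := fun a => idm (F a)) _.
Next Obligation. by move=> * /=; rewrite comp1m compm1. Qed.

Program Definition nat_comp (C D : category) (F G H : functor C D)
    (t : nat_trans G H) (s : nat_trans F G) : nat_trans F H :=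
  NatTrans (component := fun a => comp (t a) (s a)) _.
Next Obligation.
by move=> * /=; rewrite -compmA naturality !compmA naturality.
Qed.

Record preadditive (C : category) := Preadditive {
  addm : forall a b : C, hom a b -> hom a b -> hom a b;
  zerom : forall a b : C, hom a b;
  oppm : forall a b : C, hom a b -> hom a b;
  addmA : forall a b, associative (@addm a b);
  addmC : forall a b, commutative (@addm a b);
  add0m : forall a b, left_id (zerom a b) (@addm a b);
  addNm : forall a b, left_inverse (zerom a b) (@oppm a b) (@addm a b);
  compDl : forall a b c (g h : hom b c) (f : hom a b),
    comp (addm g h) f = addm (comp g f) (comp h f);
  compDr : forall a b c (h : hom b c) (f g : hom a b),
    comp h (addm f g) = addm (comp h f) (comp h g) }.

Section abelian.
Variable C : category.

Definition is_zero_object (z : C) := forall a,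
  (exists f : hom a z, forall g, g = f) /\ (exists f : hom z a, forall g, g = f).

Definition is_mono (a b : C) (f : hom a b) :=
  forall c (g h : hom c a), comp f g = comp f h -> g = h.

Definition is_epi (a b : C) (f : hom a b) :=
  forall c (g h : hom b c), comp g f = comp h f -> g = h.

Variable A : preadditive C.

Definition is_biproduct (a b c : C) (i1 : hom a c) (i2 : hom b c)
    (p1 : hom c a) (p2 : hom c b) :=
  [/\ comp p1 i1 = idm a, comp p2 i2 = idm b,
      comp p1 i2 = zerom A b a, comp p2 i1 = zerom A a b
    & addm A (comp i1 p1) (comp i2 p2) = idm c].

Definition is_kernel (a b k : C) (f : hom a b) (i : hom k a) :=
  comp f i = zerom A k b /\
  forall c (g : hom c a), comp f g = zerom A c b ->
    exists! u : hom c k, comp i u = g.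

Definition is_cokernel (a b q : C) (f : hom a b) (p : hom b q) :=
  comp p f = zerom A a q /\
  forall c (g : hom b c), comp g f = zerom A a c ->
    exists! u : hom q c, comp u p = g.

Record is_abelian : Prop := IsAbelian {
  ab_zero : exists z, is_zero_object z;
  ab_biproduct : forall a b, exists c i1 i2 p1 p2,
    @is_biproduct a b c i1 i2 p1 p2;
  ab_kernel : forall a b (f : hom a b), exists k (i : hom k a), is_kernel f i;
  ab_cokernel : forall a b (f : hom a b), exists q (p : hom b q),
    is_cokernel f p;
  ab_mono : forall a b (i : hom a b), is_mono i ->
    exists c (f : hom b c), is_kernel f i;
  ab_epi : forall a b (p : hom a b), is_epi p ->
    exists c (f : hom c a), is_cokernel f p }.

End abelian.

Definition abelian_category (C : category) :=
  exists A : preadditive C, is_abelian A.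

Definition ball_category (M : topologicalType) (B : set (set M)) : category :=
  @Category B (fun U V => set_val U `<=` set_val V)
    (fun U => @subset_refl _ (set_val U))
    (fun U V W VW UV => subset_trans UV VW)
    (fun _ _ _ => Prop_irrelevance _ _) (fun _ _ _ => Prop_irrelevance _ _)
    (fun _ _ _ _ _ _ _ => Prop_irrelevance _ _).

Definition fVect (K : fieldType) : category :=
  @Category (vectType K) (fun V W => 'Hom(V, W)) (fun V => \1%VF)
    (fun U V W g f => (g \o f)%VF)
    (fun V W f => comp_lfun1l f) (fun V W f => comp_lfun1r f)
    (fun U V W X h g f => comp_lfunA h g f).

Definition homeomorphism (X Y : topologicalType) (f : X -> Y) :=
  continuous f /\
  exists g : Y -> X, [/\ cancel f g, cancel g f & continuous g].

Section VGVB.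
Variables (K : topologicalFieldType) (M : topologicalType) (B : set (set M)).

(* An inclusion between open balls is an isotopy equivalence, so every morphism
   of the category of balls has to be sent to an isomorphism. *)
Definition very_good (F : functor (ball_category B) (fVect K)) :=
  forall (U V : ball_category B) (j : hom U V), is_iso (fmap F j).

Definition fibre (E : Type) (p : E -> M) (x : M) : Type := p @^-1` [set x].

Definition to_fibre (E : Type) (p : E -> M) (x : M) (e : E) (pe : p e = x) :
  fibre p x := SigSub (mem_set pe).

Definition incl (U V : set M) (UV : U `<=` V) (x : U) : V :=
  SigSub (mem_set (UV _ (set_valP x))).

Record vgvb := VGVBundle {
  total : topologicalType;
  proj : total -> M;
  vfun : functor (ball_category B) (fVect K);
  triv : forall U : ball_category B,
    set_val U * fvtop (vfun U) -> proj @^-1` (set_val U);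
  proj_continuous : continuous proj;
  proj_surjective : forall x, exists e, proj e = x;
  vfun_very_good : very_good vfun;
  triv_homeo : forall U, homeomorphism (@triv U);
  VB0 : forall x, GRing.Lmodule K (fibre proj x);
  VB1 : forall U x v, proj (set_val (@triv U (x, v))) = set_val x;
  VB2 : forall (U : ball_category B) (x : set_val U),
    let triv_x (v : vfun U) : GRing.Lmodule.Pack (VB0 (set_val x)) :=
      to_fibre (VB1 x v) in
    linear triv_x /\ bijective triv_x;
  VB3 : forall (U V : ball_category B) (j : hom U V) x v,
    set_val (@triv V (incl j x, fmap vfun j v)) = set_val (@triv U (x, v)) }.

Record vgvb_hom (X Y : vgvb) := VGVBHom {
  hmap : total X -> total Y;
  hnat : nat_trans (vfun X) (vfun Y);
  hmap_continuous : continuous hmap;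
  hmap_proj : forall e, proj (hmap e) = proj e;
  hmap_triv : forall (U : ball_category B) x v,
    hmap (set_val (@triv X U (x, v))) = set_val (@triv Y U (x, hnat U v)) }.

Lemma vgvb_hom_eq (X Y : vgvb) (f g : vgvb_hom X Y) :
  hmap f = hmap g -> hnat f = hnat g -> f = g.
Proof.
case: f g => [f s fc fp ft] [g t gc gp gt] /= fg st.
by subst g t; congr VGVBHom; exact: Prop_irrelevance.
Qed.

Program Definition vgvb_id (X : vgvb) : vgvb_hom X X :=
  @VGVBHom X X id (nat_id (vfun X)) _ _ _.
Next Obligation. by move=> X x; exact: cvg_id. Qed.
Next Obligation. by []. Qed.
Next Obligation. by move=> X U x v /=; rewrite id_lfunE. Qed.

Program Definition vgvb_comp (X Y Z : vgvb) (g : vgvb_hom Y Z)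
    (f : vgvb_hom X Y) : vgvb_hom X Z :=
  @VGVBHom X Z (hmap g \o hmap f) (nat_comp (hnat g) (hnat f)) _ _ _.
Next Obligation.
by move=> X Y Z g f x; apply: continuous_comp; exact: hmap_continuous.
Qed.
Next Obligation. by move=> X Y Z g f e /=; rewrite !hmap_proj. Qed.
Next Obligation.
by move=> X Y Z g f U x v /=; rewrite !hmap_triv comp_lfunE.
Qed.

Program Definition VGVB : category :=
  @Category vgvb vgvb_hom vgvb_id vgvb_comp _ _ _.
Next Obligation.
by move=> X Y f; apply: vgvb_hom_eq => //; apply: nat_trans_eq => U; exact: comp1m.
Qed.
Next Obligation.
by move=> X Y f; apply: vgvb_hom_eq => //; apply: nat_trans_eq => U; exact: compm1.
Qed.
Next Obligation.
by move=> X Y Z W h g f; apply: vgvb_hom_eq => //; apply: nat_trans_eq => U;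
   exact: compmA.
Qed.

End VGVB.

(* Main.v *)
Require Import Defs.
From HB Require Import structures.
From mathcomp Require Import all_boot all_order all_algebra.
From mathcomp Require Import all_classical all_reals all_analysis.

Set Implicit Arguments.
Unset Strict Implicit.
Unset Printing Implicit Defensive.

Import Defs GRing.Theory.
Local Open Scope classical_set_scope.
Local Open Scope ring_scope.

(** The idea is that a very good vector bundle is the same thing as the functor
    underlying it. Sending (E, pi, F) to F is a functor from very good vector
    bundles to the category of functors from balls to finite dimensional vector
    spaces that invert every morphism, and this functor is

    - faithful ([hnat_inj]), because the trivializations cover the total space
      and so the component on functors determines the map of total spaces;
    - full ([vgvb_hom_of_nat_trans]): a natural transformation prescribes a map
      over each ball. Two of these prescriptions agree at a common point x
      because some ball W around x lies in both balls, the functors identify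
      the values at both balls with the value at W, and naturality together
      with (VB3) reduces the comparison to W. The resulting map is continuous
      because it is so over each ball, linear maps between finite dimensional
      spaces being continuous ([lfun_continuous]);
    - surjective on objects ([vgvb_of_functor]): given F, choose a ball around
      each point x, let the fibre over x be the value of F at this ball, and
      identify F(U) with it for every other ball U containing x through a
      smaller ball. The identifications are locally constant in x, so that the
      resulting charts U * F(U) -> E are compatible: in the finest topology
      that makes them all continuous they are open ([chart_open]).

    Being abelian can be checked after applying a functor with these three
    properties ([abelian_reflect]). Finite dimensional vector spaces form an
    abelian category ([abelian_fVect]), and functors into an abelian category
    do so too, with kernels, cokernels and biproducts formed pointwise; the
    condition that every morphism is sent to an isomorphism passes to these
    constructions, since a map induced by two isomorphisms on kernels,
    cokernels or biproducts is an isomorphism ([abelian_inverting_functors]).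
*)

(** * Preadditive categories *)

Section preadditive_theory.
Variables (C : category) (A : preadditive C).

Lemma addm_idem (a b : C) (f : hom a b) : addm A f f = f -> f = zerom A a b.
Proof. by move=> ff; rewrite -[LHS](add0m A) -(addNm A f) -addmA ff. Qed.

Lemma addmN_eq0 (a b : C) (f g : hom a b) :
  addm A f (oppm A g) = zerom A a b -> f = g.
Proof.
move=> fg; rewrite -[f](add0m A) addmC -(addNm A g) addmA fg.
exact: add0m.
Qed.

Lemma addmN (a b : C) (f : hom a b) : addm A f (oppm A f) = zerom A a b.
Proof. by rewrite addmC addNm. Qed.

Lemma comp0m (a b c : C) (f : hom a b) : comp (zerom A b c) f = zerom A a c.
Proof. by apply: addm_idem; rewrite -compDl add0m. Qed.

Lemma compm0 (a b c : C) (f : hom b c) : comp f (zerom A a b) = zerom A a c.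
Proof. by apply: addm_idem; rewrite -compDr add0m. Qed.

Lemma addm_eq0 (a b : C) (f g : hom a b) :
  addm A f g = zerom A a b -> f = oppm A g.
Proof. by move=> fg; rewrite -[RHS](add0m A) -fg -addmA addmN addmC add0m. Qed.

Lemma compNm (a b c : C) (g : hom b c) (f : hom a b) :
  comp (oppm A g) f = oppm A (comp g f).
Proof. by apply: addm_eq0; rewrite -compDl addNm comp0m. Qed.

Lemma compmN (a b c : C) (g : hom b c) (f : hom a b) :
  comp g (oppm A f) = oppm A (comp g f).
Proof. by apply: addm_eq0; rewrite -compDr addNm compm0. Qed.

Lemma mono_of_trivial_kernel (a b : C) (f : hom a b) :
  (forall c (g : hom c a), comp f g = zerom A c b -> g = zerom A c a) ->
  is_mono f.
Proof.
move=> f0 c g h fgh; apply: addmN_eq0; apply: f0.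
by rewrite compDr fgh -compDr addmN compm0.
Qed.

Lemma epi_of_trivial_cokernel (a b : C) (f : hom a b) :
  (forall c (g : hom b c), comp g f = zerom A a c -> g = zerom A b c) ->
  is_epi f.
Proof.
move=> f0 c g h fgh; apply: addmN_eq0; apply: f0.
by rewrite compDl fgh -compDl addmN comp0m.
Qed.

Lemma kernel_mono (a b k : C) (f : hom a b) (i : hom k a) :
  is_kernel A f i -> is_mono i.
Proof.
move=> [fi univ] c g h igh.
have [|u [_ uniq]] := univ _ (comp i h); first by rewrite compmA fi comp0m.
by rewrite -(uniq g igh) -(uniq h).
Qed.

Lemma cokernel_epi (a b q : C) (f : hom a b) (p : hom b q) :
  is_cokernel A f p -> is_epi p.
Proof.
move=> [pf univ] c g h gph.
have [|u [_ uniq]] := univ _ (comp h p); first by rewrite -compmA pf compm0.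
by rewrite -(uniq g gph) -(uniq h).
Qed.

(** In the definition of an abelian category a monomorphism is a kernel of an
    unspecified morphism; this lemma replaces that morphism by the cokernel,
    which, unlike it, can be chosen naturally along a functor. *)
Lemma kernel_of_cokernel (a b c q : C) (i : hom a b) (f : hom b c)
    (p : hom b q) :
  is_kernel A f i -> is_cokernel A i p -> is_kernel A p i.
Proof.
move=> [fi ker] [pi coker]; split=> // d g pg0; apply: ker.
by have [u [<- _]] := coker _ f fi; rewrite -compmA pg0 compm0.
Qed.

Lemma cokernel_of_kernel (a b c k : C) (p : hom a b) (f : hom c a)
    (i : hom k a) :
  is_cokernel A f p -> is_kernel A p i -> is_cokernel A i p.
Proof.
move=> [pf coker] [pi ker]; split=> // d g gi0; apply: coker.
by have [u [<- _]] := ker _ f pf; rewrite compmA gi0 comp0m.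
Qed.

End preadditive_theory.

(** * Reflecting abelianness *)

(** Surjectivity on objects is meant up to equality rather than isomorphism, so
    that an object of D can be replaced by an image P c, and a morphism of D be
    lifted, without transport along isomorphisms. *)
Section reflection.
Variables (C D : category) (P : functor C D).
Hypothesis full : forall a b (g : hom (P a) (P b)), exists f, fmap P f = g.
Hypothesis faithful : forall a b (f g : hom a b), fmap P f = fmap P g -> f = g.
Hypothesis surj : forall d : D, exists c, P c = d.

Let lift a b (g : hom (P a) (P b)) : hom a b := sval (cid (full g)).

Let liftK a b (g : hom (P a) (P b)) : fmap P (lift g) = g.
Proof. exact: svalP (cid (full g)). Qed.

Section reflect_preadditive.
Variable A : preadditive D.

Program Definition reflect_preadditive : preadditive C := @Preadditive C
  (fun a b f g => lift (addm A (fmap P f) (fmap P g)))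
  (fun a b => lift (zerom A (P a) (P b)))
  (fun a b f => lift (oppm A (fmap P f))) _ _ _ _ _ _.
Next Obligation.
by move=> a b f g h; apply: faithful; rewrite !liftK addmA.
Qed.
Next Obligation. by move=> a b f g; rewrite addmC. Qed.
Next Obligation. by move=> a b f; apply: faithful; rewrite !liftK add0m. Qed.
Next Obligation. by move=> a b f; apply: faithful; rewrite !liftK addNm. Qed.
Next Obligation.
by move=> *; apply: faithful; rewrite fmapM !liftK !fmapM compDl.
Qed.
Next Obligation.
by move=> *; apply: faithful; rewrite fmapM !liftK !fmapM compDr.
Qed.
Local Notation A' := reflect_preadditive.

Let fmap0 a b : fmap P (zerom A' a b) = zerom A (P a) (P b).
Proof. exact: liftK. Qed.

Let reflect_kernel a b k (f : hom a b) (i : hom k a) :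
  is_kernel A (fmap P f) (fmap P i) -> is_kernel A' f i.
Proof.
move=> [fi ker]; split=> [|c g fg0].
  by apply: faithful; rewrite fmapM fi fmap0.
have [|u [iu uniq]] := ker _ (fmap P g); first by rewrite -fmapM fg0 fmap0.
exists (lift u); split=> [|v iv].
  by apply: faithful; rewrite fmapM liftK.
by apply: faithful; rewrite liftK; apply: uniq; rewrite -fmapM iv.
Qed.

Let reflect_cokernel a b q (f : hom a b) (p : hom b q) :
  is_cokernel A (fmap P f) (fmap P p) -> is_cokernel A' f p.
Proof.
move=> [pf coker]; split=> [|c g gf0].
  by apply: faithful; rewrite fmapM pf fmap0.
have [|u [up uniq]] := coker _ (fmap P g); first by rewrite -fmapM gf0 fmap0.
exists (lift u); split=> [|v vp].
  by apply: faithful; rewrite fmapM liftK.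
by apply: faithful; rewrite liftK; apply: uniq; rewrite -fmapM vp.
Qed.

Let preserves_mono a b (f : hom a b) : is_mono f -> is_mono (fmap P f).
Proof.
move=> mono d; have [c <-] := surj d => g h; rewrite -(liftK g) -(liftK h).
by rewrite -!fmapM => /faithful /mono ->.
Qed.

Let preserves_epi a b (f : hom a b) : is_epi f -> is_epi (fmap P f).
Proof.
move=> epi d; have [c <-] := surj d => g h; rewrite -(liftK g) -(liftK h).
by rewrite -!fmapM => /faithful /epi ->.
Qed.

Lemma reflect_is_abelian : is_abelian A -> is_abelian A'.
Proof.
case=> zero biprod ker coker mono epi; split.
- have [d] := zero; have [z <-] := surj d => zP; exists z => a.
  have [[f fP] [g gP]] := zP (P a).
  split; [exists (lift f)|exists (lift g)] => h; apply: faithful;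
    by rewrite liftK; apply: fP || apply: gP.
- move=> a b; have [d] := biprod (P a) (P b); have [c <-] := surj d.
  move=> [i1 [i2 [p1 [p2 [p1i1 p2i2 p1i2 p2i1 ip]]]]].
  exists c, (lift i1), (lift i2), (lift p1), (lift p2).
  by split; apply: faithful; rewrite ?liftK ?fmapM ?liftK ?fmap1 ?fmapM ?liftK.
- move=> a b f; have [d] := ker _ _ (fmap P f); have [k <-] := surj d.
  by move=> [i kf]; exists k, (lift i); apply: reflect_kernel; rewrite liftK.
- move=> a b f; have [d] := coker _ _ (fmap P f); have [q <-] := surj d.
  by move=> [p pf]; exists q, (lift p); apply: reflect_cokernel; rewrite liftK.
- move=> a b i /preserves_mono /mono [d]; have [c <-] := surj d.
  by move=> [f kf]; exists c, (lift f); apply: reflect_kernel; rewrite liftK.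
- move=> a b p /preserves_epi /epi [d]; have [c <-] := surj d.
  by move=> [f pf]; exists c, (lift f); apply: reflect_cokernel; rewrite liftK.
Qed.

End reflect_preadditive.

Lemma abelian_reflect : abelian_category D -> abelian_category C.
Proof.
by move=> [A /reflect_is_abelian abA]; exists (reflect_preadditive A).
Qed.

End reflection.

(** * Functors inverting all morphisms *)

(** Very good functors are the instance where the source is a category of balls
    and the target is the category of finite dimensional spaces. *)
Definition inverting (C D : category) (F : functor C D) :=
  forall a b (f : hom a b), is_iso (fmap F f).

Program Definition inverting_functors (C D : category) : category :=
  @Category {F : functor C D | inverting F}
    (fun F G => nat_trans (sval F) (sval G))
    (fun F => nat_id (sval F)) (fun F G H t s => nat_comp t s) _ _ _.
Next Obligation. by move=> *; apply: nat_trans_eq => a; exact: comp1m. Qed.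
Next Obligation. by move=> *; apply: nat_trans_eq => a; exact: compm1. Qed.
Next Obligation. by move=> *; apply: nat_trans_eq => a; exact: compmA. Qed.

Section functor_categories.
Variables C D : category.
Local Notation Fun := (inverting_functors C D).
Variable A : preadditive D.

Program Definition nat_preadditive : preadditive Fun := @Preadditive Fun
  (fun F G s t => NatTrans (component := fun a => addm A (s a) (t a)) _)
  (fun F G =>
     NatTrans (component := fun a => zerom A (sval F a) (sval G a)) _)
  (fun F G s => NatTrans (component := fun a => oppm A (s a)) _) _ _ _ _ _ _.
Next Obligation. by move=> *; rewrite /= compDl compDr !naturality. Qed.
Next Obligation. by move=> *; rewrite /= comp0m compm0. Qed.
Next Obligation. by move=> *; rewrite /= compNm compmN naturality. Qed.
Next Obligation.
by move=> F G s t u; apply: nat_trans_eq => a; exact: addmA.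
Qed.
Next Obligation. by move=> F G s t; apply: nat_trans_eq => a; exact: addmC. Qed.
Next Obligation. by move=> F G s; apply: nat_trans_eq => a; exact: add0m. Qed.
Next Obligation. by move=> F G s; apply: nat_trans_eq => a; exact: addNm. Qed.
Next Obligation. by move=> *; apply: nat_trans_eq => a; exact: compDl. Qed.
Next Obligation. by move=> *; apply: nat_trans_eq => a; exact: compDr. Qed.
Local Notation A' := nat_preadditive.

Lemma is_kernel_pointwise (F G H : Fun) (t : hom F G) (i : hom H F) :
  (forall a, is_kernel A (component t a) (component i a)) -> is_kernel A' t i.
Proof.
move=> ker; split=> [|E g tg0].
  by apply: nat_trans_eq => a; have [] := ker a.
have g0 a : comp (t a) (g a) = zerom A (sval E a) (sval G a).
  exact: (congr1 (fun s => component s a) tg0).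
pose u a := cid ((ker a).2 _ _ (g0 a)).
have iu a : comp (i a) (sval (u a)) = g a by have [] := svalP (u a).
have u_nat a b (f : hom a b) :
  comp (sval (u b)) (fmap (sval E) f) = comp (fmap (sval H) f) (sval (u a)).
  apply: (kernel_mono (ker b)).
  by rewrite compmA iu naturality compmA naturality -compmA iu.
exists (NatTrans u_nat); split=> [|v iv]; first exact: nat_trans_eq.
apply: nat_trans_eq => a; apply: (kernel_mono (ker a)).
by rewrite [LHS]iu -iv.
Qed.

Lemma is_cokernel_pointwise (F G H : Fun) (t : hom F G) (p : hom G H) :
  (forall a, is_cokernel A (component t a) (component p a)) ->
  is_cokernel A' t p.
Proof.
move=> coker; split=> [|E g gt0].
  by apply: nat_trans_eq => a; have [] := coker a.
have g0 a : comp (g a) (t a) = zerom A (sval F a) (sval E a).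
  exact: (congr1 (fun s => component s a) gt0).
pose u a := cid ((coker a).2 _ _ (g0 a)).
have up a : comp (sval (u a)) (p a) = g a by have [] := svalP (u a).
have u_nat a b (f : hom a b) :
  comp (sval (u b)) (fmap (sval H) f) = comp (fmap (sval E) f) (sval (u a)).
  apply: (cokernel_epi (coker a)).
  by rewrite -compmA -naturality compmA up naturality -compmA up.
exists (NatTrans u_nat); split=> [|v vp]; first exact: nat_trans_eq.
apply: nat_trans_eq => a; apply: (cokernel_epi (coker a)).
by rewrite [LHS]up -vp.
Qed.

Hypothesis abD : is_abelian A.

(** The universal property turns a square from [component t a] to
    [component t b] into a map between the chosen kernels, and uniqueness makes
    this assignment functorial. For the isomorphism condition, apply it to the
    inverse square, formed by the inverses of [fmap F f] and [fmap G f]. *)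
Lemma pointwise_kernel (F G : Fun) (t : hom F G) :
  exists (H : Fun) (i : hom H F),
    forall a, is_kernel A (component t a) (component i a).
Proof.
pose k a := cid (ab_kernel abD (component t a)).
pose i a := cid (svalP (k a)).
have ker a : is_kernel A (t a) (sval (i a)) := svalP (i a).
have res a b (f : hom (sval F a) (sval F b)) (g : hom (sval G a) (sval G b)) :
    comp (t b) f = comp g (t a) ->
    exists u : hom (sval (k a)) (sval (k b)),
      comp (sval (i b)) u = comp f (sval (i a)).
  move=> tf; have [] := (ker b).2 _ (comp f (sval (i a))).
    by rewrite compmA tf -compmA (ker a).1 compm0.
  by move=> u [iu _]; exists u.
have [r rP] : exists r : forall a b, hom a b -> hom (sval (k a)) (sval (k b)),
    forall a b f,
      comp (sval (i b)) (r a b f) = comp (fmap (sval F) f) (sval (i a)).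
  exists (fun a b f => sval (cid (res a b _ _ (naturality t f)))) => a b f.
  exact: (svalP (cid (res a b _ _ (naturality t f)))).
have r1 a : r a a (idm a) = idm (sval (k a)).
  by apply: (kernel_mono (ker a)); rewrite rP fmap1 comp1m compm1.
have rM a b c (g : hom b c) (f : hom a b) :
    r a c (comp g f) = comp (r b c g) (r a b f).
  apply: (kernel_mono (ker c)).
  by rewrite rP fmapM compmA rP -!compmA rP.
have r_iso a b (f : hom a b) : is_iso (r a b f).
  have [f' [f'f ff']] := svalP F a b f; have [g' [g'g gg']] := svalP G a b f.
  (* The inverses form a commutative square too. *)
  have [|s sP] := res b a f' g'.
    rewrite -[LHS]comp1m -g'g -!compmA; congr comp.
    by rewrite compmA -naturality -compmA ff' compm1.
  exists s; split.
    apply: (kernel_mono (ker a)).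
    by rewrite compmA sP -compmA rP compmA f'f comp1m compm1.
  apply: (kernel_mono (ker b)).
  by rewrite compmA rP -compmA sP compmA ff' comp1m compm1.
pose H : Fun := exist (@inverting C D) (@Functor C D _ _ r1 rM) r_iso.
by exists H, (@NatTrans C D (sval H) (sval F) (fun a => sval (i a)) rP).
Qed.

(** Dual to [pointwise_kernel]. *)
Lemma pointwise_cokernel (F G : Fun) (t : hom F G) :
  exists (H : Fun) (p : hom G H),
    forall a, is_cokernel A (component t a) (component p a).
Proof.
pose q a := cid (ab_cokernel abD (component t a)).
pose p a := cid (svalP (q a)).
have coker a : is_cokernel A (t a) (sval (p a)) := svalP (p a).
have ind a b (f : hom (sval F a) (sval F b)) (g : hom (sval G a) (sval G b)) :
    comp (t b) f = comp g (t a) ->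
    exists u : hom (sval (q a)) (sval (q b)),
      comp (sval (p b)) g = comp u (sval (p a)).
  move=> tf; have [] := (coker a).2 _ (comp (sval (p b)) g).
    by rewrite -compmA -tf compmA (coker b).1 comp0m.
  by move=> u [up _]; exists u.
have [r rP] : exists r : forall a b, hom a b -> hom (sval (q a)) (sval (q b)),
    forall a b f,
      comp (sval (p b)) (fmap (sval G) f) = comp (r a b f) (sval (p a)).
  exists (fun a b f => sval (cid (ind a b _ _ (naturality t f)))) => a b f.
  exact: (svalP (cid (ind a b _ _ (naturality t f)))).
have r1 a : r a a (idm a) = idm (sval (q a)).
  by apply: (cokernel_epi (coker a)); rewrite -rP fmap1 comp1m compm1.
have rM a b c (g : hom b c) (f : hom a b) :
    r a c (comp g f) = comp (r b c g) (r a b f).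
  apply: (cokernel_epi (coker a)).
  by rewrite -rP fmapM compmA rP -!compmA rP.
have r_iso a b (f : hom a b) : is_iso (r a b f).
  have [f' [f'f ff']] := svalP F a b f; have [g' [g'g gg']] := svalP G a b f.
  have [|s sP] := ind b a f' g'.
    rewrite -[LHS]comp1m -g'g -!compmA; congr comp.
    by rewrite compmA -naturality -compmA ff' compm1.
  exists s; split.
    apply: (cokernel_epi (coker a)).
    by rewrite -compmA -rP compmA -sP -compmA g'g comp1m compm1.
  apply: (cokernel_epi (coker b)).
  by rewrite -compmA -sP compmA -rP -compmA gg' comp1m compm1.
pose H : Fun := exist (@inverting C D) (@Functor C D _ _ r1 rM) r_iso.
by exists H, (@NatTrans C D (sval G) (sval H) (fun a => sval (p a)) rP).
Qed.

(** The sum of f and g is given by the matrix i1 f p1 + i2 g p2. *)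
Lemma pointwise_biproduct (F G : Fun) :
  exists H i1 i2 p1 p2, @is_biproduct Fun A' F G H i1 i2 p1 p2.
Proof.
pose c a := cid (ab_biproduct abD (sval F a) (sval G a)).
pose i1 a := cid (svalP (c a)); pose i2 a := cid (svalP (i1 a)).
pose p1 a := cid (svalP (i2 a)); pose p2 a := cid (svalP (p1 a)).
have bi a : is_biproduct A (sval (i1 a)) (sval (i2 a)) (sval (p1 a))
  (sval (p2 a)) := svalP (p2 a).
pose r a b (f : hom (sval F a) (sval F b)) (g : hom (sval G a) (sval G b)) :=
  addm A (comp (sval (i1 b)) (comp f (sval (p1 a))))
         (comp (sval (i2 b)) (comp g (sval (p2 a)))).
have p1r a b f g : comp (sval (p1 b)) (r a b f g) = comp f (sval (p1 a)).
  have [p1i1 _ p1i2 _ _] := bi b.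
  by rewrite compDr compmA p1i1 comp1m compmA p1i2 comp0m addmC add0m.
have p2r a b f g : comp (sval (p2 b)) (r a b f g) = comp g (sval (p2 a)).
  have [_ p2i2 _ p2i1 _] := bi b.
  by rewrite compDr compmA p2i1 comp0m add0m compmA p2i2 comp1m.
have i1r a b f g : comp (r a b f g) (sval (i1 a)) = comp (sval (i1 b)) f.
  have [p1i1 _ _ p2i1 _] := bi a.
  by rewrite compDl -!compmA p1i1 compm1 p2i1 !compm0 addmC add0m.
have i2r a b f g : comp (r a b f g) (sval (i2 a)) = comp (sval (i2 b)) g.
  have [_ p2i2 p1i2 _ _] := bi a.
  by rewrite compDl -!compmA p2i2 compm1 p1i2 !compm0 add0m.
have r1 a : r a a (idm _) (idm _) = idm _.
  by have [_ _ _ _ <-] := bi a; rewrite /r !comp1m.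
have rM a b d f g f' g' :
    r a d (comp f' f) (comp g' g) = comp (r b d f' g') (r a b f g).
  by rewrite [r a b f g]/r compDr !compmA i1r i2r /r -!compmA.
have H1 a : r a a (fmap (sval F) (idm a)) (fmap (sval G) (idm a)) = idm _.
  by rewrite !fmap1 r1.
have HM a b d (g : hom b d) (f : hom a b) :
    r a d (fmap (sval F) (comp g f)) (fmap (sval G) (comp g f)) =
    comp (r b d (fmap (sval F) g) (fmap (sval G) g))
         (r a b (fmap (sval F) f) (fmap (sval G) f)).
  by rewrite !fmapM rM.
pose H := @Functor C D _ _ H1 HM.
have H_inv : inverting H.
  move=> a b f.
  have [f' [f'f ff']] := svalP F a b f; have [g' [g'g gg']] := svalP G a b f.
  by exists (r b a f' g'); rewrite -!rM f'f g'g ff' gg' !r1.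
exists (exist (@inverting C D) H H_inv).
exists (@NatTrans C D (sval F) H (fun a => sval (i1 a))
  (fun a b f => esym (i1r a b _ _))).
exists (@NatTrans C D (sval G) H (fun a => sval (i2 a))
  (fun a b f => esym (i2r a b _ _))).
exists (@NatTrans C D H (sval F) (fun a => sval (p1 a))
  (fun a b f => p1r a b _ _)).
exists (@NatTrans C D H (sval G) (fun a => sval (p2 a))
  (fun a b f => p2r a b _ _)).
by split; apply: nat_trans_eq => a; have [] := bi a.
Qed.

Lemma pointwise_zero : exists Z : Fun, is_zero_object Z.
Proof.
have [z zP] := ab_zero abD.
have zz : is_iso (idm z) by exists (idm z); rewrite comp1m.
pose Z := @Functor C D (fun=> z) (fun _ _ _ => idm z) (fun=> erefl)
  (fun _ _ _ _ _ => esym (comp1m (idm z))).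
exists (exist (@inverting C D) Z (fun _ _ _ => zz)) => F.
have to0 d (f g : hom d z) : f = g.
  by have [[h hP] _] := zP d; rewrite (hP f) (hP g).
have of0 d (f g : hom z d) : f = g.
  by have [_ [h hP]] := zP d; rewrite (hP f) (hP g).
split.
  exists (@NatTrans C D (sval F) Z (fun a => zerom A _ _)
    (fun a b f => to0 _ _ _)).
  by move=> g; apply: nat_trans_eq => a; exact: to0.
exists (@NatTrans C D Z (sval F) (fun a => zerom A _ _)
  (fun a b f => of0 _ _ _)).
by move=> g; apply: nat_trans_eq => a; exact: of0.
Qed.

(** A pointwise kernel of a monomorphism is annihilated by it, hence vanishes
    as a transformation, hence vanishes at every object. *)
Lemma mono_pointwise (F G : Fun) (t : hom F G) :
  is_mono t -> forall a, is_mono (component t a).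
Proof.
move=> mono a; have [H [i ker]] := pointwise_kernel t.
have i0 : i = zerom A' H F.
  by apply: mono; rewrite compm0; have [] := is_kernel_pointwise ker.
apply: (mono_of_trivial_kernel (A := A)) => d g tg0.
have [u [<- _]] := (ker a).2 _ _ tg0.
by rewrite i0 /= comp0m.
Qed.

Lemma epi_pointwise (F G : Fun) (t : hom F G) :
  is_epi t -> forall a, is_epi (component t a).
Proof.
move=> epi a; have [H [p coker]] := pointwise_cokernel t.
have p0 : p = zerom A' G H.
  by apply: epi; rewrite comp0m; have [] := is_cokernel_pointwise coker.
apply: (epi_of_trivial_cokernel (A := A)) => d g gt0.
have [u [<- _]] := (coker a).2 _ _ gt0.
by rewrite p0 /= compm0.
Qed.

Lemma inverting_functors_is_abelian : is_abelian A'.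
Proof.
split.
- exact: pointwise_zero.
- exact: pointwise_biproduct.
- move=> F G t; have [H [i ker]] := pointwise_kernel t.
  by exists H, i; exact: is_kernel_pointwise.
- move=> F G t; have [H [p coker]] := pointwise_cokernel t.
  by exists H, p; exact: is_cokernel_pointwise.
- move=> F G i /mono_pointwise mono; have [H [p coker]] := pointwise_cokernel i.
  exists H, p; apply: is_kernel_pointwise => a.
  by have [d [f /kernel_of_cokernel]] := ab_mono abD (mono a); apply.
- move=> F G p /epi_pointwise epi; have [H [i ker]] := pointwise_kernel p.
  exists H, i; apply: is_cokernel_pointwise => a.
  by have [d [f /cokernel_of_kernel]] := ab_epi abD (epi a); apply.
Qed.

End functor_categories.

Lemma abelian_inverting_functors (C D : category) :
  abelian_category D -> abelian_category (inverting_functors C D).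
Proof.
move=> [A abA]; exists (nat_preadditive C A).
exact: inverting_functors_is_abelian.
Qed.

(** * Finite dimensional vector spaces *)

Section finite_dimensional_spaces.
Variable K : fieldType.
Implicit Types V W : vectType K.

(** Vector spaces are von Neumann regular: every linear map has a generalized
    inverse. The projectors 1 - f^-1 f onto the kernel and 1 - f f^-1 along the
    image then yield kernels and cokernels, and f^-1 is a one-sided inverse of f
    as soon as f is a monomorphism or an epimorphism. *)
Lemma lfun_regular V W (f : 'Hom(V, W)) : (f \o (f^-1 \o f))%VF = f.
Proof.
apply/lfunP => v; rewrite !comp_lfunE limg_lfunVK //.
by rewrite memv_img ?memvf.
Qed.

Lemma lfun_cancel V W (f : 'Hom(V, W)) (g : 'Hom(W, V)) :
  (g \o f)%VF = \1%VF -> cancel f g.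
Proof. by move=> gf v; rewrite -comp_lfunE gf id_lfunE. Qed.

Lemma lfun_idempotent_split V (e : 'Hom(V, V)) : (e \o e)%VF = e ->
  exists (W : vectType K) (i : 'Hom(W, V)) (p : 'Hom(V, W)),
    (p \o i)%VF = \1%VF /\ (i \o p)%VF = e.
Proof.
move=> ee; pose U := limg e.
have eU v : e v \in U by rewrite memv_img ?memvf.
exists (subvs_of U), (linfun vsval), (linfun (vsproj U) \o e)%VF; split.
  apply/lfunP => w; apply: val_inj; rewrite !comp_lfunE id_lfunE !lfunE /=.
  rewrite vsprojK //; have /memv_imgP[v _ ->] := subvsP w.
  by rewrite -comp_lfunE ee.
by apply/lfunP => v; rewrite !comp_lfunE !lfunE /= vsprojK.
Qed.

Lemma lfun_biproduct V W :
  exists (i1 : 'Hom(V, (V * W)%type)) (i2 : 'Hom(W, (V * W)%type))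
    (p1 : 'Hom((V * W)%type, V)) (p2 : 'Hom((V * W)%type, W)),
    [/\ (p1 \o i1 = \1)%VF, (p2 \o i2 = \1)%VF, (p1 \o i2 = 0)%VF,
        (p2 \o i1 = 0)%VF & ((i1 \o p1)%VF + (i2 \o p2)%VF = \1%VF)].
Proof.
pose inj1 (v : V) : V * W := (v, 0); pose inj2 (w : W) : V * W := (0, w).
have lin1 : linear inj1 by move=> k u v; congr pair; rewrite /= scaler0 addr0.
have lin2 : linear inj2 by move=> k u v; congr pair; rewrite /= scaler0 addr0.
pose i1 : {linear V -> (V * W)%type} :=
  HB.pack inj1 (GRing.isLinear.Build _ _ _ _ inj1 lin1).
pose i2 : {linear W -> (V * W)%type} :=
  HB.pack inj2 (GRing.isLinear.Build _ _ _ _ inj2 lin2).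
exists (linfun i1), (linfun i2), (linfun fst), (linfun snd).
split; apply/lfunP => x;
  rewrite ?add_lfunE ?zero_lfunE ?comp_lfunE ?id_lfunE ?lfunE //=.
by case: x => v w; congr pair; rewrite /= ?addr0 ?add0r.
Qed.

Definition fVect_preadditive : preadditive (fVect K) := @Preadditive (fVect K)
  (fun V W f g => f + g) (fun V W => 0) (fun V W f => - f)
  (fun V W => @addrA _) (fun V W => @addrC _) (fun V W => @add0r _)
  (fun V W => @addNr _)
  (fun U V W g h f => comp_lfunDl g h f) (fun U V W h f g => comp_lfunDr h f g).
Local Notation A := fVect_preadditive.

(** Splitting a projector e onto the kernel of f produces a kernel of f. *)
Lemma split_kernel (V W U : fVect K) (f : hom V W) (e : hom V V)
    (i : hom U V) (p : hom V U) :
  comp f e = zerom A V W ->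
  (forall T (g : hom T V), comp f g = zerom A T W -> comp e g = g) ->
  comp p i = idm U -> comp i p = e -> is_kernel A f i.
Proof.
move=> fe eg pi ip; split.
  by rewrite -(compm1 i) -pi (compmA i) ip compmA fe (comp0m A).
move=> T g /eg g0; exists (comp p g); split; first by rewrite compmA ip.
by move=> u <-; rewrite compmA pi comp1m.
Qed.

Lemma split_cokernel (V W U : fVect K) (f : hom V W) (e : hom W W)
    (i : hom U W) (p : hom W U) :
  comp e f = zerom A V W ->
  (forall T (g : hom W T), comp g f = zerom A V T -> comp g e = g) ->
  comp p i = idm U -> comp i p = e -> is_cokernel A f p.
Proof.
move=> ef ge pi ip; split.
  by rewrite -(comp1m p) -pi -!compmA (compmA i) ip ef (compm0 A).
move=> T g /ge g0; exists (comp g i); split; first by rewrite -compmA ip.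
by move=> u <-; rewrite -compmA pi compm1.
Qed.

Lemma fVect_is_abelian : is_abelian A.
Proof.
split.
- exists ('rV[K]_0 : vectType K) => V; split; exists 0 => g; apply/lfunP => v.
    by apply/rowP => -[].
  by rewrite (_ : v = 0) ?linear0 //; apply/rowP => -[].
- move=> V W; have [i1 [i2 [p1 [p2 bi]]]] := lfun_biproduct V W.
  by exists ((V * W)%type : vectType K), i1, i2, p1, p2.
- move=> V W f; pose e : 'Hom(V, V) := \1%VF - (f^-1 \o f)%VF.
  have fe : (f \o e = 0)%VF.
    by rewrite /e comp_lfunDr comp_lfunNr comp_lfun1r lfun_regular subrr.
  have eP (T : vectType K) (g : 'Hom(T, V)) : (f \o g = 0 -> e \o g = g)%VF.
    move=> fg0; rewrite /e comp_lfunDl comp_lfunNl comp_lfun1l -comp_lfunA fg0.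
    by rewrite comp_lfun0r subr0.
  have [U [i [p [pi ip]]]] := lfun_idempotent_split (eP _ e fe).
  by exists U, i; apply: (split_kernel fe eP pi ip).
- move=> V W f; pose e : 'Hom(W, W) := \1%VF - (f \o f^-1)%VF.
  have ef : (e \o f = 0)%VF.
    rewrite /e comp_lfunDl comp_lfunNl comp_lfun1l -comp_lfunA lfun_regular.
    exact: subrr.
  have eP (T : vectType K) (g : 'Hom(W, T)) : (g \o f = 0 -> g \o e = g)%VF.
    move=> gf0; rewrite /e comp_lfunDr comp_lfunNr comp_lfun1r comp_lfunA gf0.
    by rewrite comp_lfun0l subr0.
  have [U [i [p [pi ip]]]] := lfun_idempotent_split (eP _ e ef).
  by exists U, p; apply: (split_cokernel ef eP pi ip).
- move=> V W i mono; have ri : (i^-1 \o i)%VF = \1%VF.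
    by apply: mono; rewrite /= lfun_regular comp_lfun1r.
  exists W, (\1%VF - (i \o i^-1)%VF); split.
    rewrite /= comp_lfunDl comp_lfunNl comp_lfun1l -comp_lfunA ri.
    by rewrite comp_lfun1r subrr.
  move=> T g /eqP; rewrite /= comp_lfunDl comp_lfunNl comp_lfun1l.
  rewrite subr_eq0 -comp_lfunA => /eqP g_im.
  exists (i^-1 \o g)%VF; split=> // u <-.
  by rewrite comp_lfunA ri comp_lfun1l.
- move=> V W p epi; have rp : (p \o p^-1)%VF = \1%VF.
    by apply: epi; rewrite /= -comp_lfunA lfun_regular comp_lfun1l.
  exists V, (\1%VF - (p^-1 \o p)%VF); split.
    rewrite /= comp_lfunDr comp_lfunNr comp_lfun1r comp_lfunA rp.
    by rewrite comp_lfun1l subrr.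
  move=> T g /eqP; rewrite /= comp_lfunDr comp_lfunNr comp_lfun1r.
  rewrite subr_eq0 comp_lfunA => /eqP g_im.
  exists (g \o p^-1)%VF; split=> // u <-.
  by rewrite -comp_lfunA rp comp_lfun1r.
Qed.

Lemma abelian_fVect : abelian_category (fVect K).
Proof. by exists fVect_preadditive; exact: fVect_is_abelian. Qed.

End finite_dimensional_spaces.

(** * Linear maps are continuous *)

Section linear_continuity.
Variable K : topologicalFieldType.

Lemma mx_entry_continuous (T : topologicalType) m n (i : 'I_m) (j : 'I_n) :
  continuous (fun A : 'M[T]_(m, n) => A i j).
Proof.
move=> A S S_Aij.
exists (fun k l => if (k == i) && (l == j) then S else setT) => [k l|C CS].
  by case: ifPn => [/andP[/eqP-> /eqP->] //|_]; exact: filterT.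
by have /= := CS i j; rewrite !eqxx.
Qed.

Lemma continuous2_at (T U V W : topologicalType) (h : U * V -> W)
    (f : T -> U) (g : T -> V) (x : T) : continuous h ->
  {for x, continuous f} -> {for x, continuous g} ->
  {for x, continuous (fun y => h (f y, g y))}.
Proof.
by move=> hc fx gx; apply: (cvg_comp _ _ (cvg_pair fx gx)); exact: hc.
Qed.

Lemma sum_continuous_at (T : topologicalType) (I : Type) (r : seq I)
    (f : I -> T -> K) (x : T) :
  (forall i, {for x, continuous (f i)}) ->
  {for x, continuous (fun y => \sum_(i <- r) f i y)}.
Proof.
move=> fx; elim: r => [|i r IH].
  rewrite (_ : (fun y => _) = fun=> 0); first exact: cvg_cst.
  by apply/funext => y; rewrite big_nil.
rewrite (_ : (fun y => _) = fun y => f i y + \sum_(j <- r) f j y); last first.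
  by apply/funext => y; rewrite big_cons.
exact: (continuous2_at (@add_continuous K) (fx i) IH).
Qed.

Lemma mulmx_continuous m n (A : 'M[K]_(m, n)) :
  continuous (fun u : 'rV[K]_m => u *m A).
Proof.
move=> u S [P uP PS].
have : nbhs u [set v : 'rV_m |
    forall ij : 'I_1 * 'I_n, P ij.1 ij.2 ((v *m A) ij.1 ij.2)].
  apply: (filter_forall (F := nbhs u)) => -[i j] /=.
  have cont : {for u, continuous (fun v : 'rV[K]_m => (v *m A) i j)}.
    rewrite (_ : (fun v : 'rV_m => _) = (fun v => \sum_k v i k * A k j)).
      apply: sum_continuous_at => k.
      apply: (@continuous2_at _ _ _ _ (fun z : K * K => z.1 * z.2)
        (fun v : 'rV_m => v i k) (fun=> A k j)).
      - exact: mul_continuous.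
      - exact: mx_entry_continuous.
      - exact: cst_continuous.
    by apply/funext => v; rewrite mxE.
  exact: (cont _ (uP i j)).
by apply: filterS => v vP; apply: PS => i j; exact: (vP (i, j)).
Qed.

(** In coordinates a linear map is multiplication by a fixed matrix, which only
    involves the addition and multiplication of K. *)
Lemma lfun_continuous (V W : vectType K) (f : 'Hom(V, W)) :
  continuous (f : fvtop V -> fvtop W).
Proof.
pose c (U : vectType K) (u : U) := \row_i coord (vbasis fullv) i u.
pose A := \matrix_(i < \dim (@fullv K V)) c W (f (vbasis fullv)`_i).
apply: continuous_comp_initial.
rewrite (_ : _ \o _ = mulmxr A \o c V).
  move=> v; apply: continuous_comp; first exact: initial_continuous.
  exact: mulmx_continuous.
apply/funext => v; apply/rowP => j; rewrite !mxE.
rewrite [in LHS](coord_vbasis (memvf v)) !linear_sum.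
by apply: eq_bigr => i _; rewrite !linearZ !mxE.
Qed.

End linear_continuity.

(** * Open bijections and transport of module structures *)

Lemma homeomorphism_of_open_map (X Y : topologicalType) (f : X -> Y) :
  continuous f -> bijective f -> (forall A, open A -> open (f @` A)) ->
  homeomorphism f.
Proof.
move=> fc [g fK gK] fo; split=> //; exists g; split=> //.
apply/continuousP => A /fo; rewrite (_ : f @` A = g @^-1` A) //.
apply/seteqP; split=> [_ [x Ax <-]|y Ay]; first by rewrite /= fK.
by exists (g y).
Qed.

Section transported_module.
Variables (R : pzRingType) (V : lmodType R) (T : Type).
Variables (f : V -> T) (g : T -> V).
Hypotheses (fK : cancel f g) (gK : cancel g f).

(** The two cancellation proofs are arguments, so that the instances below,
    which depend on f and g, can be found from the type alone. *)
Definition transported of cancel f g & cancel g f : Type := T.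
Local Notation T' := (transported fK gK).
HB.instance Definition _ := gen_eqMixin T'.
HB.instance Definition _ := gen_choiceMixin T'.

Let add (x y : T') : T' := f (g x + g y).
Let opp (x : T') : T' := f (- g x).
Let scale (a : R) (x : T') : T' := f (a *: g x).

Let addA : associative add.
Proof. by move=> x y z; rewrite /add !fK addrA. Qed.
Let addC : commutative add.
Proof. by move=> x y; rewrite /add addrC. Qed.
Let add0 : left_id (f 0 : T') add.
Proof. by move=> x; rewrite /add fK add0r gK. Qed.
Let addN : left_inverse (f 0 : T') opp add.
Proof. by move=> x; rewrite /add /opp fK addNr. Qed.
HB.instance Definition _ := GRing.isZmodule.Build T' addA addC add0 addN.

Let scaleA a b x : scale a (scale b x) = scale (a * b) x.
Proof. by rewrite /scale fK scalerA. Qed.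
Let scale1 : left_id 1 scale.
Proof. by move=> x; rewrite /scale scale1r gK. Qed.
Let scaleDr : right_distributive scale +%R.
Proof.
move=> a x y; change (scale a (add x y) = add (scale a x) (scale a y)).
by rewrite /scale /add !fK scalerDr.
Qed.
Let scaleDl x : {morph scale^~ x : a b / a + b}.
Proof.
move=> a b; change (scale (a + b) x = add (scale a x) (scale b x)).
by rewrite /scale /add !fK scalerDl.
Qed.
HB.instance Definition _ :=
  GRing.Zmodule_isLmodule.Build R T' scaleA scale1 scaleDr scaleDl.

Lemma transport_linear : linear (f : V -> T').
Proof.
move=> a u v; change (f (a *: u + v) = add (scale a (f u)) (f v)).
by rewrite /scale /add !fK.
Qed.

End transported_module.

Lemma lmodule_transport (R : pzRingType) (V : lmodType R) (T : Type)
    (f : V -> T) : bijective f ->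
  exists c : GRing.Lmodule R T, linear (f : V -> GRing.Lmodule.Pack c).
Proof.
move=> [g fK gK].
exists (GRing.Lmodule.class (transported fK gK : lmodType R)).
exact: (transport_linear fK gK).
Qed.

(** * Morphisms of very good vector bundles *)

Section bundles.
Variables (K : topologicalFieldType) (M : topologicalType) (B : set (set M)).
Hypothesis hB : basis B.
Local Notation Ball := (ball_category B).
Local Notation triv_of X U := (@triv K M B X U).
Implicit Types (U V W : Ball) (x : M).

Lemma ball_open U : open (set_val U).
Proof. by apply: hB.1; exact: set_valP. Qed.

Lemma ball_nbhs x (A : set M) : nbhs x A ->
  exists U : Ball, set_val U x /\ set_val U `<=` A.
Proof.
by move=> /(hB.2 x) [U [BU Ux] UA]; exists (SigSub (mem_set BU)).
Qed.

Lemma ball_around x : exists U : Ball, set_val U x.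
Proof.
by have [U [Ux _]] := ball_nbhs (@filterT _ _ (nbhs_filter x)); exists U.
Qed.

Lemma ball_inter U V x : set_val U x -> set_val V x ->
  exists W (j : @hom Ball W U) (k : @hom Ball W V), set_val W x.
Proof.
move=> Ux Vx; have [|W [Wx WUV]] := @ball_nbhs x (set_val U `&` set_val V).
  apply: open_nbhs_nbhs; split=> //; apply: openI; exact: ball_open.
by exists W, (fun y Wy => (WUV y Wy).1), (fun y Wy => (WUV y Wy).2).
Qed.

Section morphisms.
Variables X Y : vgvb K B.

Lemma triv_surj (Z : vgvb K B) U (e : total Z) : set_val U (proj e) ->
  exists (x : set_val U) (v : vfun Z U), set_val (triv_of Z U (x, v)) = e.
Proof.
move=> Ue; have [_ [g [_ gK _]]] := triv_homeo Z U.
pose O := @proj _ _ _ Z @^-1` set_val U.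
pose e' : O := SigSub (mem_set (Ue : O e)).
by exists (g e').1, (g e').2; rewrite -surjective_pairing gK.
Qed.

Lemma triv_inj (Z : vgvb K B) U : injective (triv_of Z U).
Proof. by have [_ [g [gK _ _]]] := triv_homeo Z U; exact: can_inj gK. Qed.

(** Over a ball W around the common base point and inside U and V, both v and w
    come from the value at W; there they agree, because the trivialization over
    W is injective, and naturality carries this agreement back to U and V. *)
Lemma triv_compatible (s : nat_trans (vfun X) (vfun Y)) U V
    (x : set_val U) (y : set_val V) (v : vfun X U) (w : vfun X V) :
  set_val (triv_of X _ (x, v)) = set_val (triv_of X _ (y, w)) ->
  set_val (triv_of Y _ (x, s U v)) = set_val (triv_of Y _ (y, s V w)).
Proof.
move=> xvyw; have xy : set_val x = set_val y.
  by rewrite -(VB1 (v0 := X) x v) xvyw VB1.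
have Vx : set_val V (set_val x) by rewrite xy; exact: set_valP.
have [W [j [k Wx]]] := ball_inter (set_valP x) Vx.
pose z : set_val W := SigSub (mem_set Wx).
have zx : incl j z = x by exact: val_inj.
have zy : incl k z = y by exact: val_inj.
have [j' [_ jj']] := vfun_very_good X j.
have [k' [_ kk']] := vfun_very_good X k.
have vE : v = fmap (vfun X) j (j' v) by rewrite (lfun_cancel jj').
have wE : w = fmap (vfun X) k (k' w) by rewrite (lfun_cancel kk').
have key U' (i : @hom Ball W U') (u : vfun X W) :
    s U' (fmap (vfun X) i u) = fmap (vfun Y) i (s W u).
  have := congr1 (fun f : 'Hom(_, _) => f u) (naturality s i).
  by rewrite /= !comp_lfunE.
have vw : j' v = k' w.
  have : triv_of X _ (z, j' v) = triv_of X _ (z, k' w).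
    by apply: val_inj; rewrite -!set_valE -(VB3 j) -(VB3 k) zx zy -vE -wE.
  by move=> /triv_inj [].
by rewrite vE wE -{1}zx -zy !key !VB3 vw.
Qed.

Lemma vgvb_hom_of_nat_trans (s : nat_trans (vfun X) (vfun Y)) :
  exists f : vgvb_hom X Y, hnat f = s.
Proof.
have /choice[h hP] : forall e : total X, exists e' : total Y,
    forall U (x : set_val U) (v : vfun X U),
      set_val (triv_of X _ (x, v)) = e ->
      set_val (triv_of Y _ (x, s U v)) = e'.
  move=> e; have [U Ue] := ball_around (proj e).
  have [x [v xv]] := triv_surj Ue.
  exists (set_val (triv_of Y _ (x, s U v))) => V y w yw.
  by apply: triv_compatible; rewrite yw xv.
have h_triv U (x : set_val U) (v : vfun X U) :
    h (set_val (triv_of X _ (x, v))) = set_val (triv_of Y _ (x, s U v)).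
  by rewrite -(hP _ U x v erefl).
have h_proj e : proj (h e) = proj e.
  have [U Ue] := ball_around (proj e); have [x [v <-]] := triv_surj Ue.
  by rewrite h_triv !VB1.
suff h_cont : continuous h by exists (VGVBHom h_cont h_proj h_triv).
move=> e; have [U Ue] := ball_around (proj e).
pose O : set (total X) := @proj _ _ _ X @^-1` set_val U.
have oO : open O.
  by apply: open_comp (ball_open U) => ? _; exact: proj_continuous.
suff : {within O, continuous h}.
  by rewrite continuous_open_subspace // => /(_ e); apply; rewrite inE.
apply/subspace_sigL_continuousP.
have [_ [g [_ gK gc]]] := triv_homeo X U; have [tc _] := triv_homeo Y U.
pose m (p : set_val U * fvtop (vfun X U)) : set_val U * fvtop (vfun Y U) :=
  (p.1, s U p.2).
have mc : continuous m.
  move=> p; have p1 : {for p, continuous fst} by exact: cvg_fst.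
  have p2 : {for p, continuous snd} by exact: cvg_snd.
  exact: (cvg_pair p1 (cvg_comp _ _ p2 (@lfun_continuous _ _ _ (s U) p.2))).
(* Over U, in the trivializations of X and Y, the map h is id * s U. *)
rewrite (_ : sigL O h = set_val \o (triv_of Y U \o (m \o g))); last first.
  apply/funext => e'; rewrite /sigL /= -h_triv -surjective_pairing.
  by rewrite gK.
move=> e'; have c1 := cvg_comp _ _ (gc e') (mc (g e')).
have c2 := cvg_comp _ _ c1 (tc (m (g e'))).
exact: (cvg_comp _ _ c2 (@initial_continuous _ _ set_val _)).
Qed.

Lemma hnat_inj (f g : vgvb_hom X Y) : hnat f = hnat g -> f = g.
Proof.
move=> fg; apply: vgvb_hom_eq => //; apply/funext => e.
have [U Ue] := ball_around (proj e); have [x [v <-]] := triv_surj Ue.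
by rewrite !hmap_triv fg.
Qed.

End morphisms.
End bundles.

(** * The bundle of a very good functor *)

Section bundle_of_functor.
Variables (K : topologicalFieldType) (M : topologicalType) (B : set (set M)).
Hypothesis hB : basis B.
Local Notation Ball := (ball_category B).
Variable F : functor Ball (fVect K).
Hypothesis Fgood : very_good F.
Implicit Types (U V W : Ball) (x : M).

Let fmap_comp U V W (k : @hom Ball V W) (j : @hom Ball U V)
    (l : @hom Ball U W) v :
  fmap F k (fmap F j v) = fmap F l v.
Proof.
have -> : l = comp k j by exact: (@Prop_irrelevance (set_val U `<=` set_val W)).
by rewrite fmapM /= comp_lfunE.
Qed.

Let fmap_bij U V (j : @hom Ball U V) : bijective (fmap F j).
Proof.
have [g [gj jg]] := Fgood j.
by exists g; [exact: lfun_cancel gj|exact: lfun_cancel jg].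
Qed.

Definition ball_at x : Ball := sval (cid (ball_around hB x)).

Lemma mem_ball_at x : set_val (ball_at x) x.
Proof. exact: svalP (cid (ball_around hB x)). Qed.

(** The colimit of F over the balls around x is F at any one of them, since all
    these balls are compared by isomorphisms with smaller ones. *)
Definition stalk x : vectType K := F (ball_at x).

(** Through one small ball W around x, F(U) is identified with the stalk. The
    choice of W does not matter: for another such ball, compare both with a ball
    contained in their intersection. *)
Lemma germ_exists U x : set_val U x -> exists g : 'Hom(F U, stalk x),
  forall W (j : @hom Ball W U) (k : @hom Ball W (ball_at x)), set_val W x ->
    forall v, g (fmap F j v) = fmap F k v.
Proof.
move=> Ux; have [W [j [k Wx]]] := ball_inter hB Ux (mem_ball_at x).
have [j' [j'j jj']] := Fgood j.
exists (fmap F k \o j')%VF => W' l m W'x v; rewrite comp_lfunE.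
have [W2 [p [q W2x]]] := ball_inter hB Wx W'x.
have [/= q' _ qK] := fmap_bij q.
have j'K : cancel (fmap F j) j' := lfun_cancel j'j.
rewrite -(qK v) (fmap_comp _ _ (comp l q)) (fmap_comp _ _ (comp m q)).
by rewrite -(fmap_comp j p (comp l q)) j'K (fmap_comp k p (comp m q)).
Qed.

Definition germ U (x : set_val U) : 'Hom(F U, stalk (set_val x)) :=
  sval (cid (germ_exists (set_valP x))).

Lemma germE U (x : set_val U) W (j : @hom Ball W U)
    (k : @hom Ball W (ball_at (set_val x))) v :
  set_val W (set_val x) -> germ x (fmap F j v) = fmap F k v.
Proof. by move=> Wx; exact: (svalP (cid (germ_exists (set_valP x)))). Qed.

Lemma germ_bij U (x : set_val U) : bijective (germ x).
Proof.
have [W [j [k Wx]]] := ball_inter hB (set_valP x) (mem_ball_at (set_val x)).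
have [j' j'K jK] := fmap_bij j; have [k' k'K kK] := fmap_bij k.
exists (fun w => fmap F j (k' w)) => [v|w]; last by rewrite (germE _ k) ?kK.
by rewrite -(jK v) (germE _ k) ?k'K.
Qed.

Lemma germ_fmap U V (j : @hom Ball U V) (x : set_val U) v :
  germ (incl j x) (fmap F j v) = germ x v.
Proof.
have [W [l [k Wx]]] := ball_inter hB (set_valP x) (mem_ball_at (set_val x)).
have [/= l' _ lK] := fmap_bij l.
rewrite -(lK v) (fmap_comp _ _ (comp j l)).
by rewrite (germE (x := incl j x) _ k) ?(germE _ k).
Qed.

Definition bundle_total : Type := {x : M & stalk x}.
HB.instance Definition _ := gen_eqMixin bundle_total.
HB.instance Definition _ := gen_choiceMixin bundle_total.

Definition bundle_proj (e : bundle_total) : M := projT1 e.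

Definition chart_at U (p : set_val U * fvtop (F U)) : bundle_total :=
  existT _ (set_val p.1) (germ p.1 p.2).

Definition bundle_open : set (set bundle_total) :=
  [set O | forall U, open (chart_at (U := U) @^-1` O)].

Let bundle_openT : bundle_open setT.
Proof. by move=> U; rewrite preimage_setT; exact: openT. Qed.

Let bundle_openI : setI_closed bundle_open.
Proof. by move=> O O' oO oO' U; rewrite preimage_setI; exact: openI. Qed.

Let bundle_open_bigU (I : Type) (O : I -> set bundle_total) :
  (forall i, bundle_open (O i)) -> bundle_open (\bigcup_i O i).
Proof.
by move=> oO U; rewrite preimage_bigcup; apply: bigcup_open => i _; exact: oO.
Qed.

HB.instance Definition _ := isOpenTopological.Build bundle_total
  bundle_openT bundle_openI bundle_open_bigU.

Lemma chart_continuous U : continuous (chart_at (U := U)).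
Proof. by apply/continuousP => O; exact. Qed.

Lemma bundle_proj_continuous : continuous bundle_proj.
Proof.
have base_cont U :
    continuous (fun p : set_val U * fvtop (F U) => set_val p.1 : M).
  move=> p; have p1 : {for p, continuous fst} by exact: cvg_fst.
  exact: (cvg_comp _ _ p1 (@initial_continuous _ _ set_val _)).
apply/continuousP => A oA; change (bundle_open (bundle_proj @^-1` A)) => U.
by have /continuousP := base_cont U; exact.
Qed.

Lemma stalk_inj x (v w : stalk x) :
  existT stalk x v = existT stalk x w -> v = w.
Proof.
move=> vw; have := congr1 (tagged_as (Tagged stalk v)) vw.
by rewrite !tagged_asE.
Qed.

(** In the chart over V, the image of A is the preimage of A under the change of
    charts (x, w) |-> (x, germ x^-1 (germ x w)). Near a given point x the second
    component is a linear map T independent of x, because over a ball W around x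
    inside both U and V it is the composite F(V) -> F(W) -> F(U) of an
    inverse and a value of F. *)
Lemma chart_open U (A : set (set_val U * fvtop (F U))) :
  open A -> open (chart_at (U := U) @` A).
Proof.
rewrite openE => oA; change (bundle_open (chart_at (U := U) @` A)) => V.
rewrite openE => -[y0 w0] [[x0 v0] Av0].
rewrite /chart_at /= => xy.
have x0y0 : set_val x0 = set_val y0 := congr1 (@projT1 _ _) xy.
have Ux : set_val U (set_val y0) by rewrite -x0y0; exact: set_valP.
have [W [j [k Wy0]]] := ball_inter hB Ux (set_valP y0).
have [k' [k'k kk']] := Fgood k; pose T : 'Hom(F V, F U) := (fmap F j \o k')%VF.
have germT (z : set_val W) w : germ (incl j z) (T w) = germ (incl k z) w.
  by rewrite comp_lfunE germ_fmap -(germ_fmap k) (lfun_cancel kk').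
have [z [zx zy]] : exists z : set_val W, incl j z = x0 /\ incl k z = y0.
  by exists (SigSub (mem_set Wy0)); split; apply: val_inj.
subst x0 y0; move: xy => /stalk_inj; rewrite -germT.
move=> /(bij_inj (germ_bij (incl j z))) v0E; subst v0.
have [[P Q] /= [Px Qv] PQ] := oA _ Av0.
(* P is a neighbourhood in U, so it has to be moved to V through M. *)
have [_ [[P' oP' <-] P'x P'P]] := Px.
exists (set_val @^-1` (P' `&` set_val W), T @^-1` Q) => /=.
  split; last exact: lfun_continuous.
  apply: open_nbhs_nbhs; split; last by split.
  by exists (P' `&` set_val W) => //; apply: openI => //; exact: ball_open.
move=> [y w] /= [[P'y Wy] Qw]; pose z' : set_val W := SigSub (mem_set Wy).
have -> : y = incl k z' by apply: val_inj.
exists (incl j z', T w); last by rewrite /= germT.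
by apply: PQ; split=> //; apply: P'P.
Qed.

Definition bundle_triv U (p : set_val U * fvtop (F U)) :
    bundle_proj @^-1` set_val U :=
  SigSub (mem_set (set_valP p.1 : (bundle_proj @^-1` set_val U) (chart_at p))).

Lemma bundle_triv_bij U : bijective (bundle_triv (U := U)).
Proof.
have /choice[g gK] : forall e : bundle_proj @^-1` set_val U,
    exists p, bundle_triv p = e.
  move=> [[x w] xwU]; have Ux : set_val U x := set_mem xwU.
  pose y : set_val U := SigSub (mem_set Ux).
  have [g _ gK] := germ_bij y; exists (y, g w); apply: val_inj.
  by rewrite /= /chart_at /= gK.
exists g => // -[x v]; have := gK (bundle_triv (x, v)).
case: (g _) => y w /(congr1 val); rewrite /= /chart_at /= => yw.
have /val_inj yx : set_val y = set_val x := congr1 (@projT1 _ _) yw.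
by subst y; move/stalk_inj: yw => /(bij_inj (germ_bij x)) ->.
Qed.

Lemma bundle_triv_homeo U : homeomorphism (bundle_triv (U := U)).
Proof.
apply: homeomorphism_of_open_map.
- by apply: continuous_comp_initial; exact: chart_continuous.
- exact: bundle_triv_bij.
move=> A /chart_open oA; exists (chart_at (U := U) @` A) => //.
apply/seteqP; split=> [e [p Ap pe]|_ [p Ap <-]]; last by exists p.
by exists p => //; apply: val_inj.
Qed.

Definition stalk_fibre x (w : stalk x) : fibre bundle_proj x :=
  to_fibre (erefl : bundle_proj (existT _ x w) = x).

Lemma stalk_fibre_bij x : bijective (@stalk_fibre x).
Proof.
have /choice[g gK] : forall e : fibre bundle_proj x,
    exists w, stalk_fibre w = e.
  move=> [[y w] yw]; have yx : y = x := set_mem yw; subst y.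
  by exists w; apply: val_inj.
exists g => // w; have /(congr1 val) := gK (stalk_fibre w).
by move=> /= /stalk_inj.
Qed.

Definition fibre_lmodule x : GRing.Lmodule K (fibre bundle_proj x) :=
  sval (cid (lmodule_transport (stalk_fibre_bij x))).

Lemma stalk_fibre_linear x :
  linear (@stalk_fibre x : _ -> GRing.Lmodule.Pack (fibre_lmodule x)).
Proof. exact: (svalP (cid (lmodule_transport (stalk_fibre_bij x)))). Qed.

Lemma vgvb_of_functor : exists X : vgvb K B,
  exist (@inverting Ball (fVect K)) (vfun X) (@vfun_very_good _ _ _ X) =
  exist _ F Fgood.
Proof.
unshelve eexists (@VGVBundle K M B bundle_total bundle_proj F bundle_triv
  bundle_proj_continuous _ Fgood bundle_triv_homeo fibre_lmodule _ _ _).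
- by move=> x; exists (existT (fun y => stalk y : Type) x 0).
- by [].
- move=> U x /=; set t := (t in linear t).
  have tE v : t v = stalk_fibre (germ x v) by apply: val_inj.
  split.
    by move=> a u v; rewrite !tE linearP stalk_fibre_linear.
  apply: (eq_bij (bij_comp (stalk_fibre_bij _) (germ_bij x))) => v /=.
  exact: (esym (tE v)).
- move=> U V j x v /=; rewrite /chart_at /=.
  congr existT; exact: germ_fmap.
- by [].
Qed.

End bundle_of_functor.

Theorem theorem1p4 (R : realType) (n : nat) (M : smooth_manifold R n)
    (K : topologicalFieldType) (B : set (set M)) (hB : basis B)
    (hball : forall U, B U -> diffeomorphic_to_open_ball U) :
  abelian_category (VGVB K B).
Proof.
pose P := @Functor (VGVB K B) (inverting_functors (ball_category B) (fVect K))
  (fun X => exist _ (vfun X) (@vfun_very_good _ _ _ X))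
  (fun X Y f => hnat f) (fun=> erefl) (fun _ _ _ _ _ => erefl).
apply: (@abelian_reflect _ _ P).
- by move=> X Y s; exact: (vgvb_hom_of_nat_trans hB).
- by move=> X Y f g; exact: (hnat_inj hB).
- by move=> [F Fgood]; have [X XF] := vgvb_of_functor hB Fgood; exists X.
exact/abelian_inverting_functors/abelian_fVect.
Qed.
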